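(* For every signed graph $[G,\Sigma]$, $$\chi_s[G,\Sigma]\le \psi_s[G,\Sigma]\le \psi_{\max}[G,\Sigma].$$
   Context: All graphs are finite, undirected and simple (no loops, no multiple edges). 2-edge-colored and signed graphs: a 2-edge-colored graph $(G,C)$ is a graph $G$ with a set $C\subseteq E(G)$ of negative edges (the signature); the edges of $E(G)\setminus C$ are positive. Re-signing at a vertex $v$ means inverting the sign of all edges incident with $v$. Two 2-edge-colored graphs $(G,C)$ and $(G,D)$ are equivalent if one is obtained from the other by a series of re-signings. A signed graph $[G,\Sigma]$ (with $\Sigma\subseteq E(G)$) is the equivalence class of $(G,\Sigma)$; its elements are its representatives, and $(G,C)\in[G,\Sigma]$ means that $(G,C)$ is a representative of $[G,\Sigma]$. Colorings: a $k$-coloring of $(G,C)$ is a map $\alpha:V(G)\to\{1,\dots,k\}$ such that $\alpha(u)\ne\alpha(v)$ for every $uv\in E(G)$ and, for every two colors $i,j$, all edges $uv$ with $\alpha(u)=i$ and $\alpha(v)=j$ have the same sign. $\chi_2(G,C)$ is the smallest $k$ for which $(G,C)$ admits a $k$-coloring. $\chi_s[G,\Sigma]$ is the smallest $k$ for which $[G,\Sigma]$ admits a representative $(G,C)$ with $\chi_2(G,C)=k$. Homomorphisms: a homomorphism of $(G,C)$ to $(H,D)$ is a map $\varphi:V(G)\to V(H)$ such that $uv\in E(G)$ implies $\varphi(u)\varphi(v)\in E(H)$ and, for every edge $uv\in E(G)$, $uv\in C$ if and only if $\varphi(u)\varphi(v)\in D$. A signed homomorphism of $[G,\Sigma]$ to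 $[H,\Pi]$ is a map $\varphi:V(G)\to V(H)$ which is a homomorphism of some representative of $[G,\Sigma]$ to some representative of $[H,\Pi]$. A homomorphism is surjective if its co-domain is the image of its domain, i.e. every vertex and every edge of $H$ is the image of a vertex, respectively an edge, of $G$. Write $(G,C)\rightarrow_2(H,D)$, respectively $[G,\Sigma]\rightarrow_s[H,\Pi]$, if there is a surjective (respectively surjective signed) homomorphism. Cliques and achromatic numbers: a 2-edge-colored clique (respectively signed clique) is a 2-edge-colored graph (respectively signed graph) which is its unique image under surjective homomorphisms, up to isomorphism; equivalently, one whose chromatic number $\chi_2$ (respectively $\chi_s$) equals its number of vertices. $\psi_2(G,C)$ is the largest order of a 2-edge-colored clique $(K,D)$ with $(G,C)\rightarrow_2(K,D)$. $\psi_s[G,\Sigma]$ is the largest order of a signed clique $[K,\Pi]$ with $[G,\Sigma]\rightarrow_s[K,\Pi]$. Finally $\psi_{\max}[G,\Sigma]=\max\{\psi_2(G,C) : (G,C)\in[G,\Sigma]\}$. *)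

(* Defs.v *)
From Stdlib Require Import ClassicalEpsilon.
From HB Require Import structures.
From mathcomp Require Import all_boot.

Set Implicit Arguments.
Unset Strict Implicit.
Unset Printing Implicit Defensive.

(* [smallest P] and [largest P] are the least and the greatest n satisfying P.
   They are unspecified when no such n exists; see smallestP and largestP. *)
Definition smallest (P : nat -> Prop) : nat :=
  epsilon (inhabits 0) (fun n => P n /\ forall m, P m -> n <= m).

Definition largest (P : nat -> Prop) : nat :=
  epsilon (inhabits 0) (fun n => P n /\ forall m, P m -> m <= n).

Lemma smallestP (P : nat -> Prop) :
  (exists n, P n) ->
  P (smallest P) /\ forall m, P m -> smallest P <= m.
Proof.
pose Q n := P n /\ forall m, P m -> n <= m.
move=> [n Pn]; apply: (epsilon_spec (inhabits 0) Q).
elim/ltn_ind: n Pn => n IHn Pn.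
have [[m [Pm lt_mn]]|no_m] := classic (exists m, P m /\ m < n).
  exact: IHn lt_mn Pm.
exists n; split=> // m Pm; rewrite leqNgt; apply/negP=> lt_mn.
by apply: no_m; exists m.
Qed.

Lemma largestP (P : nat -> Prop) (b : nat) :
  (exists n, P n) -> (forall n, P n -> n <= b) ->
  P (largest P) /\ forall m, P m -> m <= largest P.
Proof.
pose Q n := P n /\ forall m, P m -> m <= n.
move=> [n Pn] Pb; apply: (epsilon_spec (inhabits 0) Q).
have [|[m [Pm Dk]] k_le] := @smallestP (fun k => exists m, P m /\ k = b - m) _.
  by exists (b - n), n.
exists m; split=> // p Pp; rewrite -(leq_sub2lE m (Pb p Pp)) -Dk.
by apply: k_le; exists p.
Qed.

Record graph := Graph {
  vertex :> finType;
  edges : {set {set vertex}};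
  edges_card2 : forall e, e \in edges -> #|e| = 2
}.

(* The set of negative edges. *)
Record signature (G : graph) := Signature {
  neg :> {set {set G}};
  neg_sub : neg \subset edges G
}.

HB.instance Definition _ (G : graph) := [isSub for @neg G].
HB.instance Definition _ (G : graph) := [Finite of signature G by <:].

Section OneGraph.
Variable G : graph.
Implicit Types C D : signature G.

Lemma resign_subproof C (v : G) :
  [set e in edges G | (e \in C) (+) (v \in e)] \subset edges G.
Proof. by apply/subsetP=> e; rewrite inE => /andP[]. Qed.

Definition resign C (v : G) : signature G := Signature (resign_subproof C v).

Definition resign_equiv : rel (signature G) :=
  connect [rel C D | [exists v : G, D == resign C v]].

(* The signed graph [G, Sigma], as the set of its representatives. *)
Definition signed (Sigma : signature G) : {set signature G} :=
  [set C | resign_equiv Sigma C].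

Definition is_coloring C (k : nat) (alpha : G -> 'I_k) : Prop :=
  (forall u v : G, [set u; v] \in edges G -> alpha u <> alpha v) /\
  (forall (i j : 'I_k) (u v u' v' : G),
     [set u; v] \in edges G -> [set u'; v'] \in edges G ->
     alpha u = i -> alpha v = j -> alpha u' = i -> alpha v' = j ->
     ([set u; v] \in neg C) = ([set u'; v'] \in neg C)).

Definition chi2 C : nat :=
  smallest (fun k => exists alpha : G -> 'I_k, is_coloring C alpha).

Definition chi_s (X : {set signature G}) : nat :=
  smallest (fun k => exists2 C, C \in X & chi2 C = k).

End OneGraph.

Section TwoGraphs.
Variables G H : graph.
Implicit Types (C : signature G) (D : signature H) (phi : G -> H).
Implicit Types (X : {set signature G}) (Y : {set signature H}).

Definition is_hom C D phi : Prop :=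
  forall u v : G, [set u; v] \in edges G ->
    [set phi u; phi v] \in edges H /\
    ([set u; v] \in neg C <-> [set phi u; phi v] \in neg D).

(* X and Y are signed graphs, i.e. sets of representatives. *)
Definition is_signed_hom X Y phi : Prop :=
  exists C D, [/\ C \in X, D \in Y & is_hom C D phi].

Definition is_surjective phi : Prop :=
  (forall y : H, exists x : G, y = phi x) /\
  (forall f, f \in edges H -> exists2 e, e \in edges G & f = phi @: e).

Definition surj_hom2 C D : Prop :=
  exists phi, is_hom C D phi /\ is_surjective phi.

Definition surj_hom_s X Y : Prop :=
  exists phi, is_signed_hom X Y phi /\ is_surjective phi.

Definition is_iso C D phi : Prop :=
  [/\ bijective phi,
      forall u v : G,
        [set u; v] \in edges G <-> [set phi u; phi v] \in edges H
    & forall u v : G, [set u; v] \in edges G ->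
        ([set u; v] \in neg C <-> [set phi u; phi v] \in neg D)].

Definition iso2 C D : Prop := exists phi, is_iso C D phi.

Definition iso_s X Y : Prop :=
  exists phi C D, [/\ C \in X, D \in Y & is_iso C D phi].

End TwoGraphs.

Definition clique2 (K : graph) (D : signature K) : Prop :=
  forall (H : graph) (F : signature H), surj_hom2 D F -> iso2 D F.

Definition clique_s (K : graph) (Y : {set signature K}) : Prop :=
  forall (H : graph) (Pi : signature H),
    surj_hom_s Y (signed Pi) -> iso_s Y (signed Pi).

(* The maxima below exist: the order of a surjective image of G is at most
   #|G|, and a surjective image of minimal order is a clique. *)
Definition psi2 (G : graph) (C : signature G) : nat :=
  largest (fun n => exists (K : graph) (D : signature K),
    [/\ clique2 D, surj_hom2 C D & #|K| = n]).

Definition psi_s (G : graph) (X : {set signature G}) : nat :=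
  largest (fun n => exists (K : graph) (Pi : signature K),
    [/\ clique_s (signed Pi), surj_hom_s X (signed Pi) & #|K| = n]).

Definition psi_max (G : graph) (X : {set signature G}) : nat :=
  \max_(C in X) psi2 C.

(* Main.v *)
Require Import Defs.
From mathcomp Require Import all_boot.

Set Implicit Arguments.
Unset Strict Implicit.
Unset Printing Implicit Defensive.

(** Both inequalities come from comparing orders of homomorphic images.

    First inequality.  Among the surjective signed images of [G, Sigma] choose
    one, [K, Pi], of least order.  It is a signed clique: an image of [K, Pi] is
    again an image of [G, Sigma] ([surj_hom_s_trans]), so it cannot be smaller
    than K, and a surjective homomorphism onto a graph that is not smaller than
    its source is an isomorphism ([surj_hom_iso]).  Hence #|K| is at most psi_s.
    On the other hand the homomorphism to K is a colouring of some
    representative of [G, Sigma] with the vertices of K as colours, so chi_s is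
    at most #|K| ([chi_s_le_image]).

    Second inequality.  Let [K, Pi] be a signed clique of order psi_s which is
    the image of [G, Sigma]; the homomorphism maps some representative (G, C) to
    some representative (K, D).  Here (K, D) is a 2-edge-coloured clique
    ([clique_s_representative]), so psi_s = #|K| is at most psi2 (G, C), one of
    the numbers whose maximum is psi_max.

    The only delicate point is that signed homomorphisms compose: the
    representatives of the middle graph used by the two maps may differ.  A
    re-signing of the target at v is matched by re-signing the source at every
    vertex of the fibre of v ([hom_resign_equiv]). *)

Lemma edge_neq (G : graph) (u v : G) : [set u; v] \in edges G -> u != v.
Proof. by move=> /edges_card2; rewrite cards2; case: (u != v). Qed.

(** * Re-signing *)

Lemma signature_eq (G : graph) (C D : signature G) :
  neg C = neg D -> C = D.
Proof. exact: val_inj. Qed.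

Lemma resignK (G : graph) (C : signature G) (v : G) :
  resign (resign C v) v = C.
Proof.
apply: signature_eq; apply/setP=> e; rewrite !inE.
have [eG|eNG] /= := boolP (e \in edges G); first by rewrite addbK.
by apply/esym/negbTE/(contra _ eNG)/subsetP/neg_sub.
Qed.

Lemma resign_equiv_refl (G : graph) (C : signature G) : resign_equiv C C.
Proof. exact: connect0. Qed.

Lemma resign_equiv_trans (G : graph) (C D E : signature G) :
  resign_equiv C D -> resign_equiv D E -> resign_equiv C E.
Proof. exact: connect_trans. Qed.

Lemma resign_equiv1 (G : graph) (C : signature G) (v : G) :
  resign_equiv C (resign C v).
Proof. by apply: connect1; apply/existsP; exists v. Qed.

Lemma resign_equiv_sym (G : graph) (C D : signature G) :
  resign_equiv C D -> resign_equiv D C.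
Proof.
rewrite /resign_equiv (@sym_connect_sym _ _ _) // => {}C {}D /=.
by apply/existsP/existsP=> -[v /eqP ->]; exists v; rewrite resignK.
Qed.

Lemma resign_equiv_foldr (G : graph) (C : signature G) (s : seq G) :
  resign_equiv C (foldr (fun v E => resign E v) C s).
Proof.
elim: s => [|v s IHs] /=; first exact: resign_equiv_refl.
exact: resign_equiv_trans IHs (resign_equiv1 _ _).
Qed.

(** Every re-signing at an endpoint flips the edge, so re-signing at both
    endpoints cancels out.  As s has no duplicates, membership in s gives the
    parity of the number of re-signings at each endpoint. *)
Lemma mem_resign_foldr (G : graph) (C : signature G) (s : seq G) (u v : G) :
    uniq s -> [set u; v] \in edges G ->
  ([set u; v] \in neg (foldr (fun w E => resign E w) C s)) =
  ([set u; v] \in neg C) (+) (u \in s) (+) (v \in s).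
Proof.
move=> + uvG; elim: s => [|w s IHs] /=; first by rewrite !addbF.
case/andP=> wNs /IHs {}IHs; rewrite !inE uvG IHs /= ![w == _]eq_sym.
have := edge_neq uvG.
case: (eqVneq u w) => [->|_]; case: (eqVneq v w) => [->|_];
  rewrite ?eqxx //= ?(negbTE wNs) ?addbF ?addbT //.
by rewrite addNb.
Qed.

(** * Homomorphisms *)

Lemma hom_id (G : graph) (C : signature G) : is_hom C C id.
Proof. by []. Qed.

Lemma hom_comp (G H K : graph) (C : signature G) (D : signature H)
    (E : signature K) (phi : G -> H) (psi : H -> K) :
  is_hom C D phi -> is_hom D E psi -> is_hom C E (psi \o phi).
Proof.
move=> homphi hompsi u v /homphi[/hompsi[? iffDE] iffCD]; split=> //.
exact: iff_trans iffCD iffDE.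
Qed.

Lemma surjective_id (G : graph) : @is_surjective G G id.
Proof. by split=> [y|f fG]; [exists y | exists f; rewrite ?imset_id]. Qed.

Lemma surjective_comp (G H K : graph) (phi : G -> H) (psi : H -> K) :
  is_surjective phi -> is_surjective psi -> is_surjective (psi \o phi).
Proof.
move=> [phiV phiE] [psiV psiE]; split=> [z|f /psiE[_ /phiE[e eG ->] ->]].
  by have [y ->] := psiV z; have [x ->] := phiV y; exists x.
by exists e; rewrite // imset_comp.
Qed.

(** The matching representative of the source is obtained by re-signing at the
    whole fibre of v: an edge of the source has one endpoint in that fibre if
    its image contains v, and none otherwise. *)
Lemma hom_resign (G H : graph) (C : signature G) (D : signature H)
    (phi : G -> H) (v : H) :
    is_hom C D phi ->
  exists2 C', resign_equiv C C' & is_hom C' (resign D v) phi.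
Proof.
move=> homphi; pose s := enum [pred x | phi x == v].
exists (foldr (fun w E => resign E w) C s); first exact: resign_equiv_foldr.
move=> x y xyG; have [phixyH /= iffCD] := homphi x y xyG; split=> //.
rewrite mem_resign_foldr ?enum_uniq // !mem_enum !inE phixyH /=.
have -> : ([set x; y] \in neg C) = ([set phi x; phi y] \in neg D).
  by apply/idP/idP=> /iffCD.
rewrite ![v == _]eq_sym -addbA.
have := edge_neq phixyH.
by case: (eqVneq (phi x) v) => [->|_]; case: (eqVneq (phi y) v) => [->|_].
Qed.

Lemma hom_resign_equiv (G H : graph) (C : signature G) (D D' : signature H)
    (phi : G -> H) :
    is_hom C D phi -> resign_equiv D D' ->
  exists2 C', resign_equiv C C' & is_hom C' D' phi.
Proof.
move=> + /connectP[p]; elim: p C D => [|E p IHp] C D homphi /=.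
  by move=> _ ->; exists C; first exact: resign_equiv_refl.
case/andP=> /existsP[v /eqP->] pE D'E.
have [C1 CC1 hom1] := hom_resign v homphi.
have [C2 C12 hom2] := IHp _ _ hom1 pE D'E.
by exists C2; first exact: resign_equiv_trans CC1 C12.
Qed.

Lemma mem_signed (G : graph) (C : signature G) : C \in signed C.
Proof. by rewrite inE resign_equiv_refl. Qed.

Lemma surj_hom_s_refl (G : graph) (Sigma : signature G) :
  surj_hom_s (signed Sigma) (signed Sigma).
Proof.
exists id; split; last exact: surjective_id.
by exists Sigma, Sigma; split; rewrite ?mem_signed //; apply: hom_id.
Qed.

Lemma surj_hom_s_trans (G H K : graph) (Sigma : signature G)
    (Pi : signature H) (Y : {set signature K}) :
    surj_hom_s (signed Sigma) (signed Pi) -> surj_hom_s (signed Pi) Y ->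
  surj_hom_s (signed Sigma) Y.
Proof.
move=> [phi [[C [D [CS DPi homphi]]] surjphi]].
move=> [psi [[D' [E [D'Pi EY hompsi]]] surjpsi]].
rewrite !inE in CS DPi D'Pi.
have DD' := resign_equiv_trans (resign_equiv_sym DPi) D'Pi.
have [C' CC' homphi'] := hom_resign_equiv homphi DD'.
exists (psi \o phi); split; last exact: surjective_comp.
exists C', E; split=> //; last exact: hom_comp homphi' hompsi.
by rewrite inE (resign_equiv_trans CS CC').
Qed.

(** * Orders of images *)

Lemma surjective_imsetT (G H : graph) (phi : G -> H) :
  is_surjective phi -> phi @: G = [set: H].
Proof.
move=> [phiV _]; apply/setP=> y; rewrite inE.
by have [x ->] := phiV y; rewrite imset_f.
Qed.

Lemma surjective_card (G H : graph) (phi : G -> H) :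
  is_surjective phi -> #|H| <= #|G|.
Proof.
by move=> /surjective_imsetT phiT; rewrite -cardsT -phiT leq_imset_card.
Qed.

(** Surjectivity on vertices makes the map bijective by counting; surjectivity
    on edges then forbids edges of H whose preimage pair is not an edge. *)
Lemma surj_hom_iso (G H : graph) (C : signature G) (D : signature H)
    (phi : G -> H) :
  is_hom C D phi -> is_surjective phi -> #|G| <= #|H| -> is_iso C D phi.
Proof.
move=> homphi surjphi leGH; have leHG := surjective_card surjphi.
have inj_phi : injective phi.
  suff /imset_injP inj : #|phi @: G| == #|G| by move=> x y /inj; apply.
  by rewrite (surjective_imsetT surjphi) cardsT eqn_leq leHG.
split=> [|u v|u v uvG]; last by have [] := homphi u v uvG.
  exact: inj_card_bij.
split=> [/homphi[]//|/(surjphi.2)[e eG]].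
rewrite -imset_set1 -[[set phi v]]imset_set1 -imsetU.
by move/(imset_inj inj_phi)=> ->.
Qed.

Lemma iso_s_card (G H : graph) (X : {set signature G}) (Y : {set signature H}) :
  iso_s X Y -> #|G| = #|H|.
Proof. by move=> [phi [C [D [_ _ []]]]] /bij_eq_card. Qed.

Lemma psi2_max (G K : graph) (C : signature G) (D : signature K) :
  clique2 D -> surj_hom2 C D -> #|K| <= psi2 C.
Proof.
move=> cliqueD CD.
have [||_ +] := largestP (b := #|G|) (P := fun n =>
  exists (K : graph) (D : signature K),
    [/\ clique2 D, surj_hom2 C D & #|K| = n]).
- by exists #|K|, K, D.
- by move=> _ [L [E [_ [phi [_ /surjective_card leLG]] <-]]].
by apply; exists K, D.
Qed.

(** An image of least order is a signed clique, since none of its own images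
    can have fewer vertices. *)
Lemma exists_clique_s_image (G : graph) (Sigma : signature G) :
  exists (K : graph) (Pi : signature K),
    clique_s (signed Pi) /\ surj_hom_s (signed Sigma) (signed Pi).
Proof.
pose P n := exists (K : graph) (Pi : signature K),
  surj_hom_s (signed Sigma) (signed Pi) /\ #|K| = n.
have [|[K [Pi [GK cardK]]] minP] := @smallestP P.
  by exists #|G|, G, Sigma; split=> //; apply: surj_hom_s_refl.
exists K, Pi; split=> // H F KH.
have leKH : #|K| <= #|H|.
  by rewrite cardK; apply: minP; exists H, F; split=> //;
    exact: surj_hom_s_trans GK KH.
case: KH => phi [[C [D [CPi DF homphi]]] surjphi].
by exists phi, C, D; split=> //; apply: surj_hom_iso.
Qed.

Lemma psi_sP (G : graph) (Sigma : signature G) :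
  exists (K : graph) (Pi : signature K),
    [/\ clique_s (signed Pi), surj_hom_s (signed Sigma) (signed Pi)
      & #|K| = psi_s (signed Sigma)].
Proof.
have [||+ _] := largestP (b := #|G|) (P := fun n =>
  exists (K : graph) (Pi : signature K),
    [/\ clique_s (signed Pi), surj_hom_s (signed Sigma) (signed Pi)
      & #|K| = n]) => //.
- by have [K [Pi [cK GK]]] := exists_clique_s_image Sigma; exists #|K|, K, Pi.
by move=> _ [L [E [_ [phi [_ /surjective_card leLG]] <-]]].
Qed.

(** * Colourings and cliques *)

Lemma chi2_le_hom (G H : graph) (C : signature G) (D : signature H)
    (phi : G -> H) :
  is_hom C D phi -> chi2 C <= #|H|.
Proof.
move=> homphi.
have colH : exists alpha : G -> 'I_#|H|, is_coloring C alpha.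
  exists (fun x => enum_rank (phi x)); split=> [u v /homphi[/edge_neq+ _]|].
    by move=> /eqP neq /enum_rank_inj.
  move=> _ _ u v u' v' /homphi[_ iffuv] /homphi[_ iffuv'] <- <-.
  move=> /enum_rank_inj eqx /enum_rank_inj eqy.
  rewrite eqx eqy in iffuv'.
  by apply/idP/idP=> [/iffuv/iffuv'|/iffuv'/iffuv].
have [|_ min_chi] := @smallestP (fun k =>
  exists alpha : G -> 'I_k, is_coloring C alpha); first by exists #|H|.
exact: min_chi.
Qed.

Lemma chi_s_le_image (G H : graph) (X : {set signature G})
    (Y : {set signature H}) :
  surj_hom_s X Y -> chi_s X <= #|H|.
Proof.
move=> [phi [[C [D [CX _ homphi]]] _]].
apply: leq_trans (chi2_le_hom homphi).
have [|_ min_chi] := @smallestP (fun k => exists2 C, C \in X & chi2 C = k).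
  by exists (chi2 C), C.
by apply: min_chi; exists C.
Qed.

(** An image (H, F) of (K, D) yields the signed image [H, F] of [K, Pi], which
    has the order of K; the given homomorphism is then itself an isomorphism. *)
Lemma clique_s_representative (K : graph) (Pi D : signature K) :
  clique_s (signed Pi) -> D \in signed Pi -> clique2 D.
Proof.
move=> cliquePi DPi H F [phi [homphi surjphi]].
have leKH : #|K| <= #|H|.
  rewrite (@iso_s_card _ _ (signed Pi) (signed F)) //; apply: cliquePi.
  by exists phi; split=> //; exists D, F; split; rewrite ?mem_signed.
by exists phi; apply: surj_hom_iso.
Qed.

Theorem theorem3 (G : graph) (Sigma : signature G) :
  chi_s (signed Sigma) <= psi_s (signed Sigma) /\
  psi_s (signed Sigma) <= psi_max (signed Sigma).
Proof.
have [K [Pi [cliquePi GK <-]]] := psi_sP Sigma.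
split; first exact: chi_s_le_image GK.
case: GK => phi [[C [D [CS DPi homphi]]] surjphi].
apply: leq_trans (leq_bigmax_cond _ CS).
apply: psi2_max (clique_s_representative cliquePi DPi) _.
by exists phi.
Qed.
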